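(* Let $t(n,k)$ be the number of paths in $\mathcal{M}'_1$ of length $n$ whose end-point has height $k$, and $\mathcal{T}=[t(n,k)]_{n\geq 0, k \geq 0}$. Write $Q=\sqrt{1-4z+2z^2-4z^3+z^4}$. Then $\mathcal{T}=A\cdot B$, where the matrices $A$ and $B$ are defined as follows. (1) $B=[b_{n,k}]_{n,k\geq 0}$ is given by $b_{0,0}=1$, $b_{n,0}=b_{0,n}=0$ if $n\geq 1$, and $b_{n,k}=\binom{k-1}{n-1}$ otherwise. (2) $A=[a_{n,k}]_{n,k\geq 0}$ is the almost Riordan array whose initial column has generating function $$g_0(z)=\frac{1-z^2-Q}{2z(1-z+z^2)},$$ followed by the shifted stretched Riordan array $(g(z),f(z))$ with $$g(z)=\frac{1-3z+z^2-z^3-(1-z)Q}{2z^3(1-z+z^2)},\qquad f(z)=\frac{2(1-2z-z^2-Q)}{4z}.$$ Moreover, the sequence $1,3,8,23,69,\ldots$ with generating function $g(z)$ is the convolution of the sequence $1,1,2,5,13,36,\ldots$ (OEIS A114465, with generating function $g_0(z)$) and the sequence $1,2,4,10,28,\ldots$ (OEIS A187256).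
   Context: $\mathcal{M}'_1$ is the set of lattice paths in $\mathbb{N}^2$ (with $\mathbb{N}=\{0,1,2,\dots\}$, so paths never go below the $x$-axis) starting at the origin, made of up steps $(1,k)$ with $k\ge 1$, down steps $(1,-1)$ and horizontal steps $(1,0)$, in which two up steps are never consecutive. The empty path belongs to $\mathcal{M}'_1$. The length of a path is its number of steps; the height of a point is its ordinate. The square root $Q$ is the power series with constant term $1$. An almost Riordan array (of order $1$) with initial column of generating function $g_0(z)$ followed by the shifted array $(g(z),f(z))$ is the matrix whose column $0$ has generating function $g_0(z)$ and whose column $k\ge1$ has generating function $z\,g(z)f(z)^{k-1}$; its bivariate generating function is $g_0(z)+zu\frac{g(z)}{1-uf(z)}$. ''Stretched'' refers to the fact that $f(z)$ has order greater than $1$ at $z=0$. Here OEIS A187256 is the sequence counting peakless Motzkin paths of length $n$ (steps $(1,1)$, $(1,-1)$, $(1,0)$, never below the $x$-axis, from the origin to the $x$-axis, no $(1,1)$ immediately followed by $(1,-1)$) whose horizontal steps come in $2$ colours; its generating function is $\frac{1-2z+z^2-Q}{2z^2}$. *)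

(* Defs.v *)
From HB Require Import structures.
From mathcomp Require Import all_boot all_order all_algebra finmap.
From mathcomp Require Import boolp classical_sets functions cardinality.

Set Implicit Arguments.
Unset Strict Implicit.
Unset Printing Implicit Defensive.

Import Order.TTheory GRing.Theory Num.Theory.
Local Open Scope classical_set_scope.
Local Open Scope ring_scope.

Record fps (R : Type) := Fps { fcoef : nat -> R }.

HB.instance Definition _ (R : Type) := gen_eqMixin (fps R).
HB.instance Definition _ (R : Type) := gen_choiceMixin (fps R).

Lemma fpsP (R : Type) (a b : fps R) :
  (forall n, fcoef a n = fcoef b n) -> a = b.
Proof. by case: a b => [a] [b] /= /funext ->. Qed.

Section FpsRing.
Variable R : comNzRingType.
Implicit Types a b c : fps R.

Definition fps0 : fps R := Fps (fun=> 0).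
Definition fps1 : fps R := Fps (fun n => (n == 0%N)%:R).
Definition fps_opp a : fps R := Fps (fun n => - fcoef a n).
Definition fps_add a b : fps R := Fps (fun n => fcoef a n + fcoef b n).
Definition fps_mul a b : fps R :=
  Fps (fun n => \sum_(i < n.+1) fcoef a i * fcoef b (n - i)).

Fact fps_addA : associative fps_add.
Proof. by move=> a b c; apply: fpsP => n /=; rewrite addrA. Qed.
Fact fps_addC : commutative fps_add.
Proof. by move=> a b; apply: fpsP => n /=; rewrite addrC. Qed.
Fact fps_add0 : left_id fps0 fps_add.
Proof. by move=> a; apply: fpsP => n /=; rewrite add0r. Qed.
Fact fps_addN : left_inverse fps0 fps_opp fps_add.
Proof. by move=> a; apply: fpsP => n /=; rewrite addNr. Qed.

HB.instance Definition _ :=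
  GRing.isZmodule.Build (fps R) fps_addA fps_addC fps_add0 fps_addN.

Let trunc (m : nat) a : {poly R} := \poly_(i < m.+1) fcoef a i.

Let truncE m a i : (i <= m)%N -> (trunc m a)`_i = fcoef a i.
Proof. by move=> le_im; rewrite coef_poly ltnS le_im. Qed.

Let fps_mul_trunc m a b n : (n <= m)%N ->
  fcoef (fps_mul a b) n = (trunc m a * trunc m b)`_n.
Proof.
move=> le_nm; rewrite coefM; apply: eq_bigr => i _.
by rewrite !truncE // (leq_trans _ le_nm) ?leq_subr // -ltnS.
Qed.

Fact fps_mulC : commutative fps_mul.
Proof.
by move=> a b; apply: fpsP => n; rewrite !(@fps_mul_trunc n) // mulrC.
Qed.
Fact fps_mulA : associative fps_mul.
Proof.
move=> a b c; apply: fpsP => n; transitivity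
  (trunc n a * trunc n b * trunc n c)`_n; last first.
  rewrite coefM; apply: eq_bigr => i _.
  by rewrite -fps_mul_trunc ?truncE ?leq_subr // -ltnS.
rewrite -mulrA coefM; apply: eq_bigr => i _.
by rewrite -fps_mul_trunc ?truncE ?leq_subr // -ltnS.
Qed.
Fact fps_mul1 : left_id fps1 fps_mul.
Proof.
move=> a; apply: fpsP => n /=; rewrite big_ord_recl /= mul1r subn0.
by rewrite big1 ?addr0 // => i _; rewrite mul0r.
Qed.
Fact fps_mulDl : left_distributive fps_mul fps_add.
Proof.
move=> a b c; apply: fpsP => n /=; rewrite -big_split /=.
by apply: eq_bigr => i _; rewrite mulrDl.
Qed.
Fact fps1_neq0 : fps1 != 0.
Proof.
by apply/eqP => /(congr1 (fun a : fps R => fcoef a 0)) /eqP; rewrite /= oner_eq0.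
Qed.

HB.instance Definition _ := GRing.Zmodule_isComNzRing.Build (fps R)
  fps_mulA fps_mulC fps_mul1 fps_mulDl fps1_neq0.

Definition fpsX : fps R := Fps (fun n => (n == 1%N)%:R).

(* The square root with constant term 1, and the exact quotient: the series [c]
   with [c * b = a].  Over a field of characteristic not 2 (and for [b != 0]),
   each is unique when it exists; the value is 0 when it does not. *)
Definition fps_sqrt a : fps R := xget 0 [set q | q ^+ 2 = a /\ fcoef q 0 = 1].
Definition fps_quo a b : fps R := xget 0 [set c | c * b = a].

(* In each sum [\sum_j A n j * B j k], all but finitely many terms vanish. *)
Definition is_infmx_mul (A B T : nat -> nat -> R) :=
  forall n k, exists N,
    (forall j, (N <= j)%N -> A n j * B j k = 0) /\
    T n k = \sum_(j < N) A n j * B j k.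

Definition almost_riordan (g0 g f : fps R) (n k : nat) : R :=
  if k is k'.+1 then fcoef (fpsX * g * f ^+ k') n else fcoef g0 n.

Definition stretched (f : fps R) := fcoef f 0 = 0 /\ fcoef f 1 = 0.

End FpsRing.

Arguments fpsX {R}.

Definition Bmx (n k : nat) : rat :=
  match n, k with
  | 0, 0 => 1
  | 0, _.+1 | _.+1, 0 => 0
  | n'.+1, k'.+1 => 'C(k', n')%:R
  end.

(* A path from the origin is encoded by the sequence of the ordinates of its
   steps, all abscissas being 1. *)
Definition height (w : seq int) : int := \sum_(s <- w) s.

Definition nonneg_path (w : seq int) :=
  all (fun i => 0 <= height (take i w)) (iota 0 (size w).+1).

(* [sorted] only constrains consecutive steps. *)
Definition M1 : set (seq int) :=
  [set w | [/\ all (fun s => -1 <= s) w, nonneg_path w &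
               sorted (fun r s => ~~ ((0 < r) && (0 < s))) w]].

Definition M1_paths (n k : nat) : set (seq int) :=
  [set w | [/\ M1 w, size w = n & height w = k%:Z]].

Lemma finite_M1_paths n k : finite_set (M1_paths n k).
Proof.
pose h (u : n.-tuple 'I_(n + k).+2) := [seq (i : nat)%:Z - 1 | i : 'I__ <- u].
apply: (@sub_finite_set _ _ (h @` setT)); last first.
  exact/finite_image/finite_finset.
move=> w [[/allP w_ge _ _] sz_w hw].
have le_w s : s \in w -> s <= (n + k)%:Z.
  move=> ws; have: height w = k%:Z by [].
  rewrite /height (big_rem _ ws) /= => eqk.
  have: - (size (rem s w))%:Z <= \sum_(r <- rem s w) r.
    have: {in rem s w, forall r, -1 <= r} by move=> r /mem_rem /w_ge.
    elim: (rem s w) => [|r v IHv] r_ge; first by rewrite big_nil.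
    rewrite big_cons /= -addn1 PoszD opprD addrC lerD ?r_ge ?mem_head //.
    by apply: IHv => r' vr'; rewrite r_ge // in_cons vr' orbT.
  rewrite size_rem // sz_w => ge_rest.
  have {}eqk: s = k%:Z - \sum_(r <- rem s w) r by rewrite -eqk addrK.
  rewrite eqk addnC PoszD lerD2l lerNl (le_trans _ ge_rest) // lerN2 lez_nat.
  exact: leq_pred.
pose u := [seq (inord `|s + 1| : 'I_(n + k).+2) | s <- w].
have sz_u : size u == n by rewrite size_map sz_w.
exists (Tuple sz_u) => //; rewrite /h /= -map_comp -[RHS]map_id.
apply/eq_in_map => s ws /=.
have s1_ge0 : 0 <= s + 1 by rewrite -lerBlDr sub0r w_ge.
rewrite inordK; last first.
  by rewrite -ltz_nat gez0_abs // -addn1 PoszD ltrD2r -addn1 PoszD ltzD1 le_w.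
by rewrite gez0_abs // addrK.
Qed.

Definition t (n k : nat) : nat := #|` fset_set (M1_paths n k)|.

Inductive motzkin_step := MUp | MDown | MFlat of bool.

Definition motzkin_code (s : motzkin_step) : option (option bool) :=
  match s with
  | MUp => None | MDown => Some None | MFlat c => Some (Some c)
  end.
Definition motzkin_decode (o : option (option bool)) : motzkin_step :=
  match o with
  | None => MUp | Some None => MDown | Some (Some c) => MFlat c
  end.
Lemma motzkin_codeK : cancel motzkin_code motzkin_decode.
Proof. by case. Qed.

HB.instance Definition _ := Finite.copy motzkin_step (can_type motzkin_codeK).

Definition motzkin_rise (s : motzkin_step) : int :=
  match s with MUp => 1 | MDown => -1 | MFlat _ => 0 end.

(* Peakless Motzkin paths with two colours of horizontal steps. *)
Definition A187256 (n : nat) : nat :=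
  #|[set w : n.-tuple motzkin_step |
      [&& nonneg_path [seq motzkin_rise s | s <- w],
          height [seq motzkin_rise s | s <- w] == 0 &
          sorted (fun r s => ~~ ((r == MUp) && (s == MDown))) w]]|.

(* Main.v *)
Require Import Defs.
From HB Require Import structures.
From mathcomp Require Import all_boot all_order all_algebra finmap.
From mathcomp Require Import boolp classical_sets functions cardinality.
From mathcomp Require Import zify ring.
Set Implicit Arguments.
Unset Strict Implicit.
Unset Printing Implicit Defensive.
Import Order.TTheory GRing.Theory Num.Theory.
Local Open Scope ring_scope.

(** Everything is expressed through two power series.  The first, [M], is the
    solution of [M = 1 + z (2 M - z M + z M^2)].  Solving this quadratic gives
    [Q = 1 - 2 z + z^2 - 2 z^2 M], so [M] is the closed form
    [(1 - 2 z + z^2 - Q) / (2 z^2)].  The second, [G], is the inverse of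
    [1 - z - z^2 M].  Substituting [Q] in the three quotients then gives
    [g0 = G], [g = G M] and [f = z (M - 1)], and [g = G M] is the convolution
    claimed at the end, once [M] is known to count the peakless paths.

    The combinatorial input comes from cutting off the last step of a path.
    In both families, whether a step may be appended depends only on the height
    reached and on whether the last step goes up, so these two data are the
    states of a deterministic automaton and the generating functions [X q] of
    the paths ending in state [q] satisfy the linear system
    [X q = [q = start] + z * sum of X p over the transitions p -> q].
    The factor [z] makes its solution unique, so a guessed solution only has
    to be checked ([size_words]).  The solutions are geometric in the height:
    - two-coloured peakless paths ending at height [k] have generating function
      [M (z M)^k] ([size_motzkin_words]);
    - paths without consecutive up steps have generating function [G] at
      height [0] and [z G M (1 + f)^k] at height [k + 1] ([size_M1_words]).

    The second formula is the factorisation: expanding [(1 + f)^k] by the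
    binomial theorem exhibits column [k + 1] of the counting matrix as the
    combination of the columns [z g f^j] of the almost Riordan array with
    coefficients [binomial k j], the entries of column [k + 1] of [B]. *)

(** * Formal power series *)

Lemma fcoefD (R : comNzRingType) (a b : fps R) n :
  fcoef (a + b) n = fcoef a n + fcoef b n.
Proof. by []. Qed.

Lemma fcoefN (R : comNzRingType) (a : fps R) n : fcoef (- a) n = - fcoef a n.
Proof. by []. Qed.

Lemma fcoefM (R : comNzRingType) (a b : fps R) n :
  fcoef (a * b) n = \sum_(i < n.+1) fcoef a i * fcoef b (n - i).
Proof. by []. Qed.

Lemma fcoefM0 (R : comNzRingType) (a b : fps R) :
  fcoef (a * b) 0 = fcoef a 0 * fcoef b 0.
Proof. by rewrite fcoefM big_ord1. Qed.

Lemma fcoef_sum (R : comNzRingType) (I : Type) (r : seq I) (F : I -> fps R) n :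
  fcoef (\sum_(i <- r) F i) n = \sum_(i <- r) fcoef (F i) n.
Proof. by elim/big_ind2: _ => // _ a _ b <- <-. Qed.

Lemma fcoefMn (R : comNzRingType) (a : fps R) m n :
  fcoef (a *+ m) n = fcoef a n *+ m.
Proof. by elim: m => // m IHm; rewrite !mulrS fcoefD IHm. Qed.

Lemma fcoef_nat0 (R : comNzRingType) m : fcoef (m%:R : fps R) 0 = m%:R.
Proof. exact: fcoefMn. Qed.

Lemma fcoefXM0 (R : comNzRingType) (a : fps R) : fcoef (fpsX * a) 0 = 0.
Proof. by rewrite fcoefM0 mul0r. Qed.

Lemma fcoef0_1DXM (R : comNzRingType) (a : fps R) :
  fcoef (1 + fpsX * a) 0 = 1.
Proof. by rewrite fcoefD fcoefXM0 addr0. Qed.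

Lemma fcoefXMS (R : comNzRingType) (a : fps R) n :
  fcoef (fpsX * a) n.+1 = fcoef a n.
Proof.
rewrite fcoefM 2!big_ord_recl mul0r add0r mul1r subn1 big1 ?addr0 // => i _.
by rewrite mul0r.
Qed.

Lemma fpsX_rreg (R : comNzRingType) : GRing.rreg (fpsX : fps R).
Proof.
move=> a b eq_ab; apply: fpsP => n.
by rewrite -[LHS]fcoefXMS -[RHS]fcoefXMS ![fpsX * _]mulrC eq_ab.
Qed.

(** The coefficients of a factor [b] are recovered from those of [b * a] one
    after the other, cancelling the constant term of [a] each time. *)
Lemma fps_rreg_coef0 (R : comNzRingType) (a : fps R) :
  GRing.rreg (fcoef a 0) -> GRing.rreg a.
Proof.
move=> a0_reg b c eq_bc; apply: fpsP; elim/ltn_ind => n IHn; apply: a0_reg.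
have := congr1 (fun d => fcoef d n) eq_bc.
rewrite /= !big_ord_recr /= subnn.
rewrite (eq_bigr (fun i : 'I_n => fcoef c i * fcoef a (n - i))) => [|i _].
  exact: addrI.
by rewrite IHn.
Qed.

(** The hypothesis says that [F] is contracting for the [z]-adic distance, and
    the fixed point is the limit of the iterates of [F]: coefficient [n] is
    final after [n + 1] iterations. *)
Lemma fps_fixpoint (R : comNzRingType) (F : fps R -> fps R) :
    (forall a b n, (forall i, (i < n)%N -> fcoef a i = fcoef b i) ->
       forall i, (i <= n)%N -> fcoef (F a) i = fcoef (F b) i) ->
  exists a, a = F a.
Proof.
move=> contrF; pose a := Fps (fun n => fcoef (iter n.+1 F 0) n).
have stab n m i : (i < n)%N -> (i < m)%N ->
    fcoef (iter n F 0) i = fcoef (iter m F 0) i.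
  elim: n m i => // n IHn [|m] // i lt_in lt_im.
  by apply: (contrF _ _ i) => // j lt_ji; apply: IHn; lia.
exists a; apply: fpsP => n.
by apply: (contrF _ _ n) => // i lt_in; apply: stab.
Qed.

Lemma fps_fixpointX (R : comNzRingType) (F : fps R -> fps R) :
    (forall a b n, (forall i, (i < n)%N -> fcoef a i = fcoef b i) ->
       forall i, (i < n)%N -> fcoef (F a) i = fcoef (F b) i) ->
  exists a, a = 1 + fpsX * F a.
Proof.
move=> compatF; apply: fps_fixpoint => a b n eq_ab [|i] le_in.
  by rewrite !fcoefD !fcoefXM0.
by rewrite !fcoefD !fcoefXMS (compatF a b n).
Qed.

(** Multiplication is non-expanding for the [z]-adic distance, which is what
    makes polynomial expressions admissible in [fps_fixpointX]. *)
Lemma fcoefM_eq (R : comNzRingType) (a b c d : fps R) n :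
    (forall i, (i < n)%N -> fcoef a i = fcoef b i) ->
    (forall i, (i < n)%N -> fcoef c i = fcoef d i) ->
  forall i, (i < n)%N -> fcoef (a * c) i = fcoef (b * d) i.
Proof.
move=> eq_ab eq_cd i lt_in; rewrite !fcoefM; apply: eq_bigr => j _.
rewrite eq_ab ?eq_cd //; have := ltn_ord j; lia.
Qed.

Lemma fps_quoE (R : comNzRingType) (a b c : fps R) :
  GRing.rreg b -> c * b = a -> fps_quo a b = c.
Proof.
move=> b_reg cb_a; apply: xget_unique => // d /= db_a.
by apply: b_reg; rewrite db_a.
Qed.

(** Another root [r] satisfies [(r - q) * (r + q) = 0], and the second factor has
    constant term [2], hence can be cancelled. *)
Lemma fps_sqrtE (R : comNzRingType) (a q : fps R) :
  GRing.rreg (2%:R : R) -> q ^+ 2 = a -> fcoef q 0 = 1 -> fps_sqrt a = q.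
Proof.
move=> reg2 q2_a q0; apply: xget_unique => // r /= [r2_a r0].
have: GRing.rreg (r + q).
  by apply: fps_rreg_coef0; rewrite fcoefD r0 q0.
by apply; rewrite !mulrDr -!expr2 q2_a r2_a addrC [q * r]mulrC.
Qed.

(** * The series M and G *)

(** Proves an identity modulo the relation [a = b]: the cofactor [c] is supplied
    by hand and the second premise is left to [ring]. *)
Lemma eq_of_multiple (R : pzRingType) (c a b x y : R) :
  a = b -> x - y = c * (a - b) -> x = y.
Proof. by move=> ->; rewrite subrr mulr0 => /subr0_eq. Qed.

Lemma exists_motzkin_gf (R : comNzRingType) : exists M : fps R,
  M = 1 + fpsX * (2 * M - fpsX * M + fpsX * (M * M)).
Proof.
apply: fps_fixpointX => a b n eq_ab i lt_in.
by rewrite !fcoefD !fcoefN; congr (_ - _ + _); move: i lt_in;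
   do !apply: fcoefM_eq => //.
Qed.

Lemma exists_excursion_gf (R : comNzRingType) (M : fps R) :
  exists G : fps R, G = 1 + fpsX * ((1 + fpsX * M) * G).
Proof.
by apply: fps_fixpointX => a b n eq_ab i lt_in; move: i lt_in; apply: fcoefM_eq.
Qed.

(** Completing the square in the quadratic equation of [M], whose discriminant is
    the series under the root. *)
Lemma motzkin_gf_sqrt (R : comNzRingType) (M : fps R) :
    GRing.rreg (2%:R : R) ->
    M = 1 + fpsX * (2 * M - fpsX * M + fpsX * (M * M)) ->
  fps_sqrt (1 - 4 * fpsX + 2 * fpsX ^+ 2 - 4 * fpsX ^+ 3 + fpsX ^+ 4) =
    1 - 2 * fpsX + fpsX ^+ 2 - 2 * fpsX ^+ 2 * M.
Proof.
move=> reg2 HM; apply: fps_sqrtE => //.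
  by apply: (eq_of_multiple (c := - 4 * fpsX ^+ 2) HM); ring.
have ->: 1 - 2 * fpsX + fpsX ^+ 2 - 2 * fpsX ^+ 2 * M =
    1 + fpsX * (- 2 + fpsX - 2 * fpsX * M) by ring.
exact: fcoef0_1DXM.
Qed.

(** Rationalises the inverse [G] of [1 - z - z^2 M]: up to the quadratic equation
    of [M], the conjugate factor [1 - z + z M] turns [1 - z - z^2 M] into the
    polynomial [1 - z + z^2], the one in the denominators of [g0] and [g]. *)
Lemma excursion_gf_rational (R : comNzRingType) (M G : fps R) :
    M = 1 + fpsX * (2 * M - fpsX * M + fpsX * (M * M)) ->
    G = 1 + fpsX * ((1 + fpsX * M) * G) ->
  G * (1 - fpsX + fpsX ^+ 2) = 1 - fpsX + fpsX * M.
Proof.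
move=> HM HG; have HG1 : G * (1 - fpsX - fpsX ^+ 2 * M) = 1.
  by apply: (eq_of_multiple (c := 1) HG); ring.
transitivity (G * (1 - fpsX - fpsX ^+ 2 * M) * (1 - fpsX + fpsX * M)).
  by apply: (eq_of_multiple (c := - fpsX * G) HM); ring.
by rewrite HG1 mul1r.
Qed.

(** * Words accepted by an automaton, listed from the last letter *)

(** [pre q] lists the transitions into [q], each as a source state and a letter.
    Listing transitions by their target rather than by their source keeps the
    list finite when, as for up steps of arbitrary size, a state has infinitely
    many successors. *)
Fixpoint words (S Q : eqType) (q0 : Q) (pre : Q -> seq (Q * S)) n q :
    seq (seq S) :=
  if n is n'.+1
  then [seq rcons w ps.2 | ps <- pre q, w <- words q0 pre n' ps.1]
  else if q == q0 then [:: [::]] else [::].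

(** The hypothesis on [rcons] says that acceptance [ok] and the state [st] reached
    can be computed letter by letter, following the transitions [pre]. *)
Lemma mem_words (S Q : eqType) (q0 : Q) (pre : Q -> seq (Q * S))
    (ok : pred (seq S)) (st : seq S -> Q) :
    ok [::] -> st [::] = q0 ->
    (forall w s q, (ok (rcons w s) && (st (rcons w s) == q))
       = (ok w && ((st w, s) \in pre q))) ->
  forall n q w, (w \in words q0 pre n q) = [&& size w == n, ok w & st w == q].
Proof.
move=> ok0 st0 okS; elim=> [|n IHn] q w.
  case: w => [|s w] /=; last by case: ifP.
  by rewrite ok0 st0 eq_sym; case: ifP.
apply/allpairsPdep/idP => [[[p s] [v [/= pq]]]|].
  rewrite IHn => /and3P[/eqP sz_v ok_v /eqP st_v] ->.
  by rewrite okS size_rcons sz_v eqxx ok_v st_v.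
case/lastP: w => // w s; rewrite okS size_rcons eqSS => /and3P[sz_w ok_w pre_s].
by exists (st w, s), w; rewrite IHn sz_w ok_w eqxx.
Qed.

(** A word determines its last letter and, through [st], the state before it, so
    no word is produced along two different transitions. *)
Lemma words_uniq (S Q : eqType) (q0 : Q) (pre : Q -> seq (Q * S))
    (ok : pred (seq S)) (st : seq S -> Q) :
    ok [::] -> st [::] = q0 ->
    (forall w s q, (ok (rcons w s) && (st (rcons w s) == q))
       = (ok w && ((st w, s) \in pre q))) ->
    (forall q, uniq (pre q)) ->
  forall n q, uniq (words q0 pre n q).
Proof.
move=> ok0 st0 okS uniq_pre; elim=> [|n IHn] q /=; first by case: ifP.
apply: allpairs_uniq_dep => // u v.
case/allpairsPdep=> -[p s] [w [_ pw ->]].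
case/allpairsPdep=> -[p' s'] [w' [_ pw' ->]] /= /rcons_inj[eqw eqs].
move: pw pw'; rewrite !(mem_words ok0 st0 okS) eqw eqs.
by move=> /= /and3P[_ _ /eqP stp] /and3P[_ _ /eqP stp']; rewrite -stp -stp'.
Qed.

(** The two states over [k] are reached by disjoint sets of words, so the
    concatenation lists every word once.  In both applications the boolean tells
    whether the last step goes up. *)
Lemma words_total (S K : eqType) (q0 : K * bool)
    (pre : K * bool -> seq ((K * bool) * S))
    (ok : pred (seq S)) (st : seq S -> K * bool) :
    ok [::] -> st [::] = q0 ->
    (forall w s q, (ok (rcons w s) && (st (rcons w s) == q))
       = (ok w && ((st w, s) \in pre q))) ->
    (forall q, uniq (pre q)) ->
  forall n k, let s := words q0 pre n (k, false) ++ words q0 pre n (k, true) in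
  uniq s /\ s =i [pred w | [&& size w == n, ok w & (st w).1 == k]].
Proof.
move=> ok0 st0 okS uniq_pre n k; have memE := mem_words ok0 st0 okS.
split=> [|w].
  rewrite cat_uniq !(words_uniq ok0 st0 okS uniq_pre) andbT /=.
  apply/hasPn => w; rewrite !memE => /and3P[_ _ /eqP ->].
  by rewrite xpair_eqE !andbF.
rewrite mem_cat !memE inE -!andb_orr; congr [&& _, _ & _].
by case: (st w) => j []; rewrite /= andbT.
Qed.

(** The factor [fpsX] makes coefficient [n + 1] of the system a recurrence in
    terms of coefficient [n], the one satisfied by the number of words; hence any
    solution of the system is the family of generating functions. *)
Lemma size_words (R : comNzRingType) (S Q : eqType) (q0 : Q)
    (pre : Q -> seq (Q * S)) (X : Q -> fps R) :
    (forall q, X q = (q == q0)%:R + fpsX * \sum_(ps <- pre q) X ps.1) ->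
  forall n q, fcoef (X q) n = (size (words q0 pre n q))%:R.
Proof.
move=> eqX; elim=> [|n IHn] q; rewrite eqX fcoefD.
  by rewrite fcoefXM0 addr0 /=; case: eqP.
have ->: fcoef ((q == q0)%:R : fps R) n.+1 = 0 by case: eqP.
rewrite add0r fcoefXMS fcoef_sum /= size_allpairs_dep sumnE big_map natr_sum.
exact: eq_bigr.
Qed.

(** * Extending a path by one step *)

Lemma height_rcons w s : height (rcons w s) = height w + s.
Proof. by rewrite /height big_rcons. Qed.

Lemma nonneg_path_rcons w s :
  nonneg_path (rcons w s) = nonneg_path w && (0 <= height w + s).
Proof.
rewrite /nonneg_path size_rcons -[(size w).+2]addn1 iotaD all_cat.
congr andb; last first.
  by rewrite /= andbT add0n take_oversize ?size_rcons // height_rcons.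
apply: eq_in_all => i; rewrite mem_iota => /andP[_ lt_i].
by rewrite -cats1 takel_cat.
Qed.

Lemma nonneg_path_height w : nonneg_path w -> 0 <= height w.
Proof.
case/lastP: w => [|w s]; first by rewrite /height big_nil.
by rewrite nonneg_path_rcons height_rcons => /andP[].
Qed.

(** The default [x0] stands for the letter before an empty word; it must allow
    every successor. *)
Lemma sorted_rcons_last (T : Type) (e : rel T) x0 w s :
  (forall y, e x0 y) -> sorted e (rcons w s) = sorted e w && e (last x0 w) s.
Proof. by case: w => [|x w] e0 /=; rewrite ?e0 // rcons_path. Qed.

(** * Paths without consecutive up steps *)

Definition M1ok (w : seq int) : bool :=
  [&& all (fun s => -1 <= s) w, nonneg_path w &
      sorted (fun r s => ~~ ((0 < r) && (0 < s))) w].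

Definition M1_state (w : seq int) : nat * bool := (`|height w|%N, 0 < last 0 w).

Definition M1_pre (q : nat * bool) : seq ((nat * bool) * int) :=
  let: (k, up) := q in
  if up then [seq ((j, false), (k - j)%N%:Z) | j <- iota 0 k]
  else [:: ((k, false), 0); ((k, true), 0);
           ((k.+1, false), -1); ((k.+1, true), -1)].

Lemma M1_pre_uniq q : uniq (M1_pre q).
Proof.
case: q => k [] /=; last by rewrite !inE !xpair_eqE /= !eqxx !andbF !orbF.
by rewrite map_inj_uniq ?iota_uniq // => i j [].
Qed.

Lemma M1_rcons w s q : M1ok (rcons w s) && (M1_state (rcons w s) == q) =
  M1ok w && ((M1_state w, s) \in M1_pre q).
Proof.
rewrite /M1ok all_rcons nonneg_path_rcons (sorted_rcons_last (x0 := 0)) //.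
rewrite /M1_state last_rcons height_rcons.
case: (all _ w); rewrite ?andbF //= ?andbT.
case nnw: (nonneg_path w); rewrite ?andbF //=.
case: (sorted _ w); rewrite ?andbF //=.
have := nonneg_path_height nnw; case: (height w) => // h _.
case: q => k [] /=.
  apply/idP/mapP => [/andP[/and3P[ge_s ge_hs nup] /eqP[eqk ups]]|].
    exists h; first by rewrite mem_iota; lia.
    by congr (_, _, _); [case: (0 < last 0 w) nup; rewrite ?ups | lia].
  case=> j; rewrite mem_iota => /andP[_ lt_jk] [-> -> ->] /=.
  by rewrite xpair_eqE; lia.
rewrite !inE !xpair_eqE; case: (0 < last 0 w) => /=; lia.
Qed.

(** Subtracting the equations of two consecutive states [(k, true)] eliminates
    the sum over all lower heights and leaves
    [X (k + 1, true) = X (k, true) + z X (k, false)], which is why the solution is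
    geometric in the height. *)
Lemma size_M1_words (R : comNzRingType) (M G : fps R) :
    M = 1 + fpsX * (2 * M - fpsX * M + fpsX * (M * M)) ->
    G = 1 + fpsX * ((1 + fpsX * M) * G) ->
  let P k := fpsX * G * (1 + fpsX * (M - 1)) ^+ k in
  let X (q : nat * bool) := match q with
    | (0%N, false) => G | (0%N, true) => 0
    | (k.+1, false) => (M - 1) * P k | (k.+1, true) => P k end in
  forall n q, fcoef (X q) n = (size (words (0%N, false) M1_pre n q))%:R.
Proof.
move=> HM HG P X; apply: size_words => -[k []]; last first.
  rewrite /= !big_cons big_nil /=; case: k => [|k] /=.
    by rewrite /P expr0; apply: (eq_of_multiple (c := 1) HG); ring.
  by rewrite /P exprS; apply: (eq_of_multiple (c := P k) HM); rewrite /P; ring.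
rewrite big_map /= xpair_eqE andbF add0r.
elim: k => [|k IHk]; first by rewrite big_nil mulr0.
rewrite -[k.+1]addn1 iotaD big_cat /= big_cons big_nil addr0 mulrDr -IHk.
rewrite /= /P; case: k {IHk} => [|k] /=; first by rewrite add0r expr0 mulr1.
by rewrite exprS /P; ring.
Qed.

Lemma t_words n k : t n k =
  (size (words (0%N, false) M1_pre n (k, false)) +
   size (words (0%N, false) M1_pre n (k, true)))%N.
Proof.
have state0 : M1_state [::] = (0%N, false) by rewrite /M1_state /height big_nil.
have nil_ok : M1ok [::] by rewrite /M1ok /nonneg_path /= /height big_nil.
have [uniq_s mem_s] := words_total nil_ok state0 M1_rcons M1_pre_uniq n k.
rewrite -size_cat -[RHS](congr1 size (undup_id uniq_s)) -card_fseq /t.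
congr #|` _|; apply/fsetP => w; rewrite in_fset_set; last exact: finite_M1_paths.
rewrite [RHS]in_fset mem_s inE; apply/asboolP/and3P => /=.
  by case=> /and3P okw /eqP szw ->; split.
case=> /eqP szw okw /eqP htw; split=> //; first exact/and3P.
case/and3P: okw => _ /nonneg_path_height; lia.
Qed.

(** * Two-coloured peakless Motzkin paths *)

Definition motzkin_ok (w : seq motzkin_step) : bool :=
  nonneg_path [seq motzkin_rise s | s <- w] &&
  sorted (fun r s => ~~ ((r == MUp) && (s == MDown))) w.

Definition motzkin_state (w : seq motzkin_step) : nat * bool :=
  (`|height [seq motzkin_rise s | s <- w]|%N, last (MFlat false) w == MUp).

Definition motzkin_pre (q : nat * bool) : seq ((nat * bool) * motzkin_step) :=
  match q with
  | (k, false) =>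
    [:: ((k, false), MFlat false); ((k, false), MFlat true);
        ((k, true), MFlat false); ((k, true), MFlat true);
        ((k.+1, false), MDown)]
  | (k.+1, true) => [:: ((k, false), MUp); ((k, true), MUp)]
  | (0%N, true) => [::]
  end.

Lemma motzkin_pre_uniq q : uniq (motzkin_pre q).
Proof. by case: q => [[|k] []] //=; rewrite !inE !xpair_eqE /= !andbF. Qed.

Lemma motzkin_rcons w s q :
  motzkin_ok (rcons w s) && (motzkin_state (rcons w s) == q) =
  motzkin_ok w && ((motzkin_state w, s) \in motzkin_pre q).
Proof.
rewrite /motzkin_ok /motzkin_state map_rcons nonneg_path_rcons.
rewrite (sorted_rcons_last (x0 := MFlat false)) // last_rcons height_rcons.
case nnw: (nonneg_path _); rewrite //=.
case: (sorted _ w); rewrite ?andbF //=.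
have := nonneg_path_height nnw; case: (height _) => // h _.
have stepE (r u : motzkin_step) : (r == u) = match r, u with
  | MUp, MUp | MDown, MDown => true | MFlat b, MFlat c => b == c
  | _, _ => false end by case: r u => [||[]] [||[]].
case: q => [[|k] []]; rewrite /= ?inE ?xpair_eqE; case: (last _ w == MUp);
  case: s => [||[]]; rewrite !stepE /=; lia.
Qed.

(** Both states over [k] together give [M (z M)^k]; removing the last, rising step
    of a path ending in [(k + 1, true)] leaves an arbitrary path to height [k],
    whence [z M (z M)^k] for that state. *)
Lemma size_motzkin_words (R : comNzRingType) (M : fps R) :
    M = 1 + fpsX * (2 * M - fpsX * M + fpsX * (M * M)) ->
  let X (q : nat * bool) := match q with
    | (0%N, false) => M | (0%N, true) => 0
    | (k.+1, false) => (M - 1) * (fpsX * M) ^+ k.+1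
    | (k.+1, true) => (fpsX * M) ^+ k.+1 end in
  forall n q, fcoef (X q) n = (size (words (0%N, false) motzkin_pre n q))%:R.
Proof.
move=> HM X; apply: size_words => -[[|k] []];
  rewrite /= ?big_cons big_nil /= ?xpair_eqE ?andbF /=.
- by rewrite mulr0 addr0.
- by rewrite expr1; apply: (eq_of_multiple (c := 1) HM); ring.
- by case: k => [|k]; rewrite ?expr1 ?expr0 ?exprS; ring.
rewrite !exprS.
by apply: (eq_of_multiple (c := fpsX * M * (fpsX * M) ^+ k) HM); ring.
Qed.

Lemma A187256_words n : A187256 n =
  (size (words (0%N, false) motzkin_pre n (0%N, false)) +
   size (words (0%N, false) motzkin_pre n (0%N, true)))%N.
Proof.
have state0 : motzkin_state [::] = (0%N, false).
  by rewrite /motzkin_state /height big_nil.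
have nil_ok : motzkin_ok [::].
  by rewrite /motzkin_ok /nonneg_path /= /height big_nil.
have [uniq_s mem_s] :=
  words_total nil_ok state0 motzkin_rcons motzkin_pre_uniq n 0%N.
rewrite -size_cat /A187256 cardE -(size_map val); apply: perm_size.
apply: uniq_perm => //; first by rewrite map_inj_uniq ?enum_uniq //; apply: val_inj.
move=> w; rewrite mem_s inE /=; apply/mapP/and3P => [[v]|].
  rewrite mem_enum inE => /and3P[nn ht0 srt] ->.
  by rewrite size_tuple eqxx absz_eq0 ht0 /motzkin_ok nn.
case=> szw /andP[nn srt] ht0; exists (Tuple szw) => //.
by rewrite mem_enum inE /= nn srt -absz_eq0 ht0.
Qed.

(** * The factorisation *)

Lemma t_excursion_values :
  [seq t n 0 | n <- iota 0 6] = [:: 1; 1; 2; 5; 13; 36]%N.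
Proof. by rewrite /= !t_words; vm_compute. Qed.

Lemma A187256_values :
  [seq A187256 n | n <- iota 0 5] = [:: 1; 2; 4; 10; 28]%N.
Proof. by rewrite /= !A187256_words; vm_compute. Qed.

Theorem proposition3 :
  let z : fps rat := fpsX in
  let Q := fps_sqrt (1 - 4 * z + 2 * z ^+ 2 - 4 * z ^+ 3 + z ^+ 4) in
  let g0 := fps_quo (1 - z ^+ 2 - Q) (2 * z * (1 - z + z ^+ 2)) in
  let g := fps_quo (1 - 3 * z + z ^+ 2 - z ^+ 3 - (1 - z) * Q)
                   (2 * z ^+ 3 * (1 - z + z ^+ 2)) in
  let f := fps_quo (2 * (1 - 2 * z - z ^+ 2 - Q)) (4 * z) in
  [/\ is_infmx_mul (almost_riordan g0 g f) Bmx (fun n k => (t n k)%:R),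
      stretched f,
      forall n, fcoef g n = \sum_(i < n.+1) fcoef g0 i * (A187256 (n - i))%:R &
      [/\ [seq fcoef g n | n <- iota 0 5] = [:: 1; 3; 8; 23; 69],
          [seq fcoef g0 n | n <- iota 0 6] = [:: 1; 1; 2; 5; 13; 36] &
          [seq A187256 n | n <- iota 0 5] = [:: 1; 2; 4; 10; 28]%N]].
Proof.
move=> z Q g0 g f.
have [M HM] := exists_motzkin_gf rat.
have [G HG] := exists_excursion_gf M.
have reg_nat m : GRing.rreg (m.+1%:R : fps rat).
  by apply: fps_rreg_coef0; rewrite fcoef_nat0; apply/mulIf; rewrite pnatr_eq0.
have regX := @fpsX_rreg rat.
have regD : GRing.rreg (1 - z + z ^+ 2).
  apply: fps_rreg_coef0.
  have ->: 1 - z + z ^+ 2 = 1 + fpsX * (- 1 + fpsX) by rewrite /z; ring.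
  by rewrite fcoef0_1DXM; apply: mulIf.
have HGD : G * (1 - z + z ^+ 2) = 1 - z + z * M := excursion_gf_rational HM HG.
have QE : Q = 1 - 2 * z + z ^+ 2 - 2 * z ^+ 2 * M.
  by apply: motzkin_gf_sqrt => //; apply/mulIf.
have g0E : g0 = G.
  apply: fps_quoE; first by apply: rregM => //; apply: rregM.
  by rewrite QE mulrCA HGD; ring.
have gE : g = G * M.
  apply: fps_quoE; first by apply: rregM => //; apply: rregM => //; apply: rregX.
  rewrite QE.
  transitivity (2 * z ^+ 3 * M * (G * (1 - z + z ^+ 2))); first by ring.
  rewrite HGD.
  by apply: (eq_of_multiple (c := - 2 * z ^+ 2) HM); rewrite /z; ring.
have fE : f = z * (M - 1).
  by apply: fps_quoE; [apply: rregM | rewrite QE; ring].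
have A187256E n : fcoef M n = (A187256 n)%:R.
  rewrite A187256_words natrD -!(size_motzkin_words HM).
  by rewrite /= addr0.
have tE n k : (t n k)%:R = fcoef (if k is k'.+1
    then z * g * (1 + f) ^+ k' else g0) n.
  rewrite t_words natrD -!(size_M1_words HM HG) -fcoefD; congr fcoef.
  case: k => [|k]; first by rewrite g0E addr0.
  by rewrite gE fE /z; ring.
have M0 : fcoef M 0 = 1 by rewrite HM fcoef0_1DXM.
have gconv n :
    fcoef g n = \sum_(i < n.+1) fcoef g0 i * (A187256 (n - i))%:R.
  by rewrite gE g0E fcoefM; under eq_bigr do rewrite A187256E.
have g0_t n : fcoef g0 n = (t n 0)%:R by rewrite tE.
split=> //.
- (* Column [k] of [B] vanishes below row [k], hence the truncations. *)
  move=> n [|k]; [exists 1%N | exists k.+2]; split.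
  + by case=> // j _; rewrite mulr0.
  + by rewrite big_ord1 mulr1 tE.
  + by case=> // j lt_kj; rewrite /= bin_small // mulr0.
  rewrite tE big_ord_recl mulr0 add0r exprDn mulr_sumr fcoef_sum.
  apply: eq_bigr => j _.
  by rewrite expr1n mul1r mulrnAr fcoefMn -mulr_natr.
- by rewrite /stretched fE fcoefXM0 fcoefXMS fcoefD M0 subrr.
have [t0 t1 t2 t3 t4 t5] := t_excursion_values.
have [a0 a1 a2 a3 a4] := A187256_values.
split; last exact: A187256_values.
  rewrite /= !gconv !(big_ord_recl, big_ord0) /= !g0_t.
  by rewrite t0 t1 t2 t3 t4 a0 a1 a2 a3 a4; apply/eqP.
by rewrite /= !g0_t t0 t1 t2 t3 t4 t5.
Qed.
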